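(* If $(a_1,\dots,a_n)\in\Sigma$ and $a_n<2a_1$, then $\chi(a_1,\dots,a_n)=3$.
   Context: $\Sigma$ is the set of strictly increasing sequences $a_1<\dots<a_n$ of positive integers with $\gcd(a_1,\dots,a_n)=1$. For $S=\{\pm a_1,\dots,\pm a_n\}$, the Schreier graph $G_S$ has vertex set $F(2^\mathbb{Z})=\{x\in2^\mathbb{Z}: s\cdot x\ne x\ \forall s\ne0\}$ with $(s\cdot x)(m)=x(m+s)$, and $x,y$ adjacent iff $s\cdot x=y$ for some $s\in S$. $\chi(a_1,\dots,a_n)$ is the Borel chromatic number of $G_S$ (least size of a finite discrete set $K$ admitting a Borel proper coloring $F(2^\mathbb{Z})\to K$). *)

(* Defs.v *)
From mathcomp Require Import all_boot all_order all_algebra.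
From mathcomp Require Import all_classical all_reals all_analysis.

Set Implicit Arguments.
Unset Strict Implicit.
Unset Printing Implicit Defensive.

Local Open Scope classical_set_scope.

(* [<<s @open T >>] is spelled out instead of using [g_sigma_algebraType],
   which is a measurable type only over a pointed type. *)
Definition borel_set (T : topologicalType) : set (set T) := <<s @open T >>.

Definition borel_map (T U : topologicalType) (f : T -> U) : Prop :=
  forall B : set U, borel_set B -> borel_set (f @^-1` B).

Definition borel_colorable (V : topologicalType) (adj : V -> V -> Prop)
    (k : nat) : Prop :=
  exists2 K : finType, #|K| = k &
  exists2 c : V -> discrete_topology K, borel_map c &
    forall x y : V, adj x y -> c x <> c y.

(* [None] stands for an infinite Borel chromatic number. *)
Definition borel_chromatic_number (V : topologicalType)
    (adj : V -> V -> Prop) : option nat :=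
  if pselect (exists k, `[< borel_colorable adj k >]) is left h
  then Some (ex_minn h) else None.

(* The product topology on [2^Z], with [bool] discrete. *)
Definition shift (s : int) (x : {ptws int -> bool}) : {ptws int -> bool} :=
  fun m => x (m + s)%R.

Definition free_part : set {ptws int -> bool} :=
  [set x | forall s : int, s <> 0%R -> shift s x <> x].

(* Vertices range over [free_part] as a type, with the subspace topology. *)
Definition schreier_adj (S : set int) (x y : free_part) : Prop :=
  exists2 s, S s & shift s (set_val x) = set_val y.

Definition Sigma : set (seq nat) :=
  [set a | [/\ sorted ltn a, all (fun x => 0 < x)%N a
             & \big[gcdn/0%N]_(x <- a) x = 1%N]].

Definition signed_set (a : seq nat) : set int :=
  [set s | exists2 x, x \in a & s = x%:Z%R \/ s = (- x%:Z)%R].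

Definition chi (a : seq nat) : option nat :=
  borel_chromatic_number (schreier_adj (signed_set a)).

(* Main.v *)
(* Only the smallest and largest generators h and last a <= 2h - 1 matter.

   Three colors suffice: a greedy construction over the cylinders of
   aperiodic words gives a Borel set of markers that meets every free orbit in a
   sequence with bounded gaps, all of length at least L^2, where L = 3h.  Every
   integer >= L^2 is a sum of L's and (L-1)'s, so the blocks between
   consecutive markers split into tiles of length L or L - 1.  Color x by
   u %/ h, where u < 3h is the distance from x to the last point of its tile:
   a shift by s in [h, 2h-1] either lowers u by s or, entering the next tile,
   raises it by at least L - 1 - s >= h.

   Two colors do not suffice: they would alternate under the shift by h, so the
   shift by any odd multiple of h would change the color.  But color classes
   have the Baire property, so one of them is comeager in some cylinder C, and
   then it meets its own translate by every large m, as C meets its own. *)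

From mathcomp Require Import all_boot all_order all_algebra.
From mathcomp Require Import all_classical all_reals all_analysis.
From mathcomp Require Import zify.
(* Required last: mathcomp-analysis has another [shift]. *)
Require Import Defs.

Set Implicit Arguments.
Unset Strict Implicit.
Unset Printing Implicit Defensive.

Import GRing.Theory.

Local Open Scope classical_set_scope.

Local Notation config := {ptws int -> bool}.

(** * Tilings of the integers *)

(* A block of length [e] is cut into tiles of length [L] or [L - 1]; the point at
   distance [d] from its last point is at distance [f d] from the last point of
   its tile. *)
Definition tileable (L e : nat) (f : nat -> nat) : Prop :=
  [/\ f 0 = 0, forall d, d < e -> f d < L,
      forall d, d.+1 < e -> f d.+1 = (f d).+1 \/ f d.+1 = 0 /\ L <= (f d).+2
    & L <= (f e.-1).+2].

Lemma tileable_cat (L e1 e2 : nat) (f1 f2 : nat -> nat) :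
  0 < e1 -> 0 < e2 -> tileable L e1 f1 -> tileable L e2 f2 ->
  tileable L (e1 + e2) (fun d => if d < e1 then f1 d else f2 (d - e1)).
Proof.
move=> e1_gt0 e2_gt0 [f10 f1L f1S f1e] [f20 f2L f2S f2e]; split=> [|d|d|].
- by rewrite e1_gt0.
- by case: (ltnP d e1) => [d1 _|d1 d2]; [exact: f1L | apply: f2L; lia].
- case: (ltnP d.+1 e1) => [d1 _|].
    by rewrite (ltn_trans (ltnSn d) d1); exact: f1S.
  rewrite leq_eqVlt => /orP[/eqP e1E _|d1 d2].
    by rewrite e1E ltnSn subnn f20; right; split=> //; rewrite e1E in f1e.
  by rewrite ltnNge -ltnS d1 /= subSn //; apply: f2S; lia.
- have -> : ((e1 + e2).-1 < e1) = false by lia.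
  by have -> : (e1 + e2).-1 - e1 = e2.-1 by lia.
Qed.

(** Induction on [q]: one tile is split off so that the remainder stays in the range for one tile
    fewer. *)
Lemma tileable_between (L q e : nat) :
  1 < L -> 0 < q -> q * L.-1 <= e <= q * L -> exists f, tileable L e f.
Proof.
move=> L_gt1; have tile t : L.-1 <= t <= L -> tileable L t id.
  by move=> ?; split=> // [d|d|]; lia.
elim: q e => [//|[|q] IHq] e _ eq.
  by exists id; apply: tile; rewrite !mul1n in eq.
(* The short tile is taken whenever the rest then fits into [q.+1] tiles; otherwise
   [e = q.+2 * L]. *)
pose t := if e <= q.+1 * L + L.-1 then L.-1 else L.
have [tL te] : L.-1 <= t <= L /\ q.+1 * L.-1 <= e - t <= q.+1 * L.
  have qL : q.+1 * L.-1 <= q.+1 * L by rewrite leq_mul2l leq_pred.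
  rewrite !(mulSn q.+1) in eq.
  by rewrite /t; case: ifPn => ?; split; lia.
have [//|f ft] := IHq (e - t) _ te.
have t0 : 0 < t by lia.
have et0 : 0 < e - t by nia.
exists (fun d => if d < t then id d else f (d - t)).
have -> : e = t + (e - t) by lia.
exact: tileable_cat (tile _ tL) ft.
Qed.

(** Start from [e %/ L.-1] tiles of length [L.-1]. The remainder is smaller than [L.-1], hence than
    the number of tiles, and is absorbed by lengthening that many tiles by one. *)
Lemma tileable_large (L e : nat) :
  1 < L -> L * L <= e -> exists f, tileable L e f.
Proof.
move=> L1 Le; have L0 : 0 < L.-1 by lia.
have eE := divn_eq e L.-1; have rlt := ltn_pmod e L0.
have qL : L.-1 <= e %/ L.-1 by rewrite leq_divRL //; nia.
by apply: (@tileable_between L (e %/ L.-1)) => //; nia.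
Qed.

Section sawtooth.
Variables (a : nat) (v : nat -> nat).
Hypothesis a_gt0 : 0 < a.
Hypothesis vS : forall n, v n = (v n.+1).+1 \/ v n = 0 /\ 3 * a <= (v n.+1).+2.

Lemma sawtooth_down (n k : nat) : k <= v n -> v (n + k) = v n - k.
Proof.
elim: k => [|k IHk] kv; first by rewrite addn0 subn0.
by rewrite addnS; case: (vS (n + k)); lia.
Qed.

Lemma sawtooth_color (s : nat) :
  a <= s < 2 * a -> v 0 %/ a <> v s %/ a.
Proof.
move=> sa; have [sv|vs] := leqP s (v 0).
  have -> : v s = v 0 - s by rewrite -(sawtooth_down sv).
  have : v 0 - s + 1 * a <= v 0 by lia.
  by move/(leq_div2r a); rewrite divnDMl //; lia.
have := sawtooth_down (leqnn (v 0)); rewrite add0n subnn => v0.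
have [|[_ vL]] := vS (v 0); first by lia.
(* Here [s - (v 0).+1 <= 2 * a - 2], while [v (v 0).+1 >= 3 * a - 2]: no second tile end is
   crossed. *)
have := @sawtooth_down (v 0).+1 (s - (v 0).+1); rewrite subnKC // => vsE.
have : v 0 + 1 * a <= v s by rewrite vsE; lia.
by move/(leq_div2r a); rewrite divnDMl //; lia.
Qed.

End sawtooth.

(** * Borel markers *)

Section borel_sets.
Variable T : topologicalType.
Implicit Types (A B : set T) (F : nat -> set T).

Lemma borel_open A : open A -> borel_set A.
Proof. exact: sub_sigma_algebra. Qed.

Lemma borelC A : borel_set A -> borel_set (~` A).
Proof.
have [_ bC _] := smallest_sigma_algebra [set: T] (@open T).
by rewrite -setTD; exact: bC.
Qed.

Lemma borel_bigcup F : (forall n, borel_set (F n)) -> borel_set (\bigcup_n F n).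
Proof.
by have [_ _ bU] := smallest_sigma_algebra [set: T] (@open T); exact: bU.
Qed.

Lemma borel_bigcap F : (forall n, borel_set (F n)) -> borel_set (\bigcap_n F n).
Proof.
move=> bF; rewrite -[X in borel_set X]setCK setC_bigcap.
by apply: borelC; apply: borel_bigcup => n; exact: borelC.
Qed.

Lemma borelU A B : borel_set A -> borel_set B -> borel_set (A `|` B).
Proof.
by move=> bA bB; rewrite -bigcup2E; apply: borel_bigcup => -[|[|n]] //=;
  apply: borel_open; exact: open0.
Qed.

Lemma borelI A B : borel_set A -> borel_set B -> borel_set (A `&` B).
Proof.
move=> bA bB; rewrite -[A `&` B]setCK setCI.
by apply: borelC; apply: borelU; exact: borelC.
Qed.

Lemma borel_const (P : Prop) : borel_set [set _ : T | P].
Proof.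
apply: borel_open; have [p|np] := pselect P.
  have -> : [set _ : T | P] = setT by apply/seteqP; split.
  exact: openT.
have -> : [set _ : T | P] = set0 by apply/seteqP; split.
exact: open0.
Qed.

Lemma borel_implies (P : Prop) A :
  (P -> borel_set A) -> borel_set [set x | P -> A x].
Proof.
move=> bA; have [p|np] := pselect P.
  have -> : [set x | P -> A x] = A by apply/seteqP; split=> [x /(_ p)|x Ax _].
  exact: bA.
have -> : [set x | P -> A x] = [set _ | True].
  by apply/seteqP; split=> // x _ /np.
exact: borel_const.
Qed.

End borel_sets.

Lemma continuous_borel_map (T U : topologicalType) (f : T -> U) :
  continuous f -> borel_map f.
Proof.
move=> /continuousP cf B.
apply: (smallest_sub (X := [set B | borel_set (f @^-1` B)])).
  split=> [|A /= bA|F /= bF].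
  - by rewrite /= preimage_set0; apply: borel_open; exact: open0.
  - by rewrite setTD preimage_setC; exact: borelC.
  - by rewrite preimage_bigcup; exact: borel_bigcup.
by move=> A oA; apply: borel_open; exact: cf.
Qed.

Lemma eval_continuous (i : int) : continuous (fun x : config => x i).
Proof. exact: (@proj_continuous int (fun=> bool) i). Qed.

Definition cylinder (n : nat) (x : config) : set config :=
  [set y | forall i : int, (`|i| < n)%N -> y i = x i].

Lemma cylinder_le (m n : nat) (x : config) :
  m <= n -> cylinder n x `<=` cylinder m x.
Proof. by move=> mn y xy i im; apply: xy; exact: leq_trans im mn. Qed.

Lemma cylinder_trans (m n : nat) (x y : config) :
  m <= n -> cylinder m x y -> cylinder n y `<=` cylinder m x.
Proof.
move=> mn xy z yz i im.
by rewrite yz ?xy // (leq_trans im mn).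
Qed.

(** The filter generated by the cylinders around [x] converges to [x], which in the product topology
    need only be checked coordinate by coordinate. *)
Lemma open_cylinder_sub (U : set config) (x : config) :
  open U -> U x -> exists n, cylinder n x `<=` U.
Proof.
move=> oU Ux.
have FF : Filter (filter_from [set: nat] (cylinder^~ x)).
  apply: filter_fromT_filter; first by exists 0.
  by move=> i j; exists (maxn i j) => y xy; split;
    apply: cylinder_le xy; rewrite ?leq_maxl ?leq_maxr.
suff : filter_from [set: nat] (cylinder^~ x) --> (x : config).
  move=> /(_ U (open_nbhs_nbhs (conj oU Ux))).
  by case=> n _ xU; exists n.
apply/cvg_sup => i A [B [[C oC <-] Cx CA]].
exists (`|i|%N.+1) => // y xy; apply: CA => /=.
by rewrite /= xy.
Qed.

Lemma shiftD (s t : int) (x : config) :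
  shift s (shift t x) = shift (s + t)%R x.
Proof. by apply/funext => m; rewrite /shift addrA. Qed.

Lemma shift0 (x : config) : shift 0%R x = x.
Proof. by apply/funext => m; rewrite /shift addr0. Qed.

Lemma shift_continuous (s : int) : continuous (shift s).
Proof.
move=> x; apply/cvg_sup => i A [B [[C oC <-] Cx CA]].
have xC := @eval_continuous (i + s)%R x C (open_nbhs_nbhs (conj oC Cx)).
have sub : (fun y : config => y (i + s)%R) @^-1` C `<=` shift s @^-1` A.
  by move=> y Cy; exact: CA.
exact: filterS sub xC.
Qed.

Lemma free_shift (s : int) (x : config) : free_part x -> free_part (shift s x).
Proof.
move=> Fx t t0 /(congr1 (shift (- s)%R)).
rewrite !shiftD addNr shift0 (_ : (- s + t + s = t)%R); last by lia.
exact: Fx.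
Qed.

(** Such a word cannot occur in a configuration at two places less than [D] apart. *)
Definition aperiodic (D : nat) (w : seq bool) : Prop :=
  forall s, 0 < s < D ->
    exists2 i, i + s < size w & nth false w i <> nth false w (i + s).

Definition occurs (c : nat) (w : seq bool) : set config :=
  [set x | forall i, i < size w -> x (i%:Z - c%:Z)%R = nth false w i].

(** A countable cover of the free part by Borel sets, indexed by coded pairs of a word and the index
    in it that falls on coordinate 0. Within a piece, no two points differ by a shift [s] with
    [0 < s < D]. *)
Definition piece (D n : nat) : set config :=
  if (unpickle n : option (nat * seq bool)) is Some (c, w)
  then [set x | aperiodic D w /\ occurs c w x] else set0.

Lemma borel_piece (D n : nat) : borel_set (piece D n).
Proof.
rewrite /piece; case: unpickle => [[c w]|]; last first.
  by apply: borel_open; exact: open0.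
apply: borelI; first exact: borel_const.
rewrite (_ : occurs c w = \bigcap_i
    [set x : config | i < size w -> x (i%:Z - c%:Z)%R = nth false w i]).
  apply: borel_bigcap => i; apply: borel_implies => _; apply: borel_open.
  have /continuousP ci := @eval_continuous (i%:Z - c%:Z)%R.
  exact: (ci [set nth false w i] (discrete_open _)).
by apply/seteqP; split=> x ox i => [_|]; exact: ox.
Qed.

Lemma piece_discrete (D n s : nat) (x : config) :
  0 < s < D -> piece D n x -> ~ piece D n (shift s x).
Proof.
rewrite /piece; case: unpickle => [[c w]|//] sD [aw ox] [_ osx].
have [i iw] := aw s sD; apply.
rewrite -(osx i) ?(leq_ltn_trans (leq_addr s i)) // -(ox (i + s)) //.
by rewrite /shift; congr (x _); rewrite PoszD addrAC.
Qed.

(** By freeness [x] disagrees with each of its translates by [0 < s < D] at some coordinate; a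
    window that shows all these disagreements is an aperiodic word. *)
Lemma free_piece (D : nat) (x : config) :
  free_part x -> exists n, piece D n x.
Proof.
move=> Fx.
have /choice[f fP] (s : nat) : exists i : int, 0 < s -> x i <> x (i + s%:Z)%R.
  have [->|s0] := eqVneq s 0; first by exists 0%R.
  have /existsNP[i xi] : ~ (forall i, shift s%:Z x i = x i).
    by move=> /funext; apply: Fx; lia.
  by exists i => _ xE; apply: xi; rewrite /shift xE.
(* The word on the coordinates from [- c] to [c + D - 1] contains both [f s] and [f s + s] for all
   [s < D]. *)
pose c := \max_(s < D) `|f s|%N.
have cf s : s < D -> (`|f s| <= c)%N.
  by move=> sD; rewrite /c (bigmax_sup (Ordinal sD)).
pose w := mkseq (fun j => x (j%:Z - c%:Z)%R) (c + c + D).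
have wE j : j < c + c + D -> nth false w j = x (j%:Z - c%:Z)%R.
  by move=> jw; rewrite nth_mkseq.
exists (pickle (c, w)); rewrite /piece pickleK /=; split=> [s /andP[s0 sD]|j].
  have := cf s sD => fc.
  have jE : (`|(f s + c%:Z)%R|%N%:Z = f s + c%:Z)%R by lia.
  exists `|(f s + c%:Z)%R|%N; first by rewrite size_mkseq; lia.
  rewrite !wE ?PoszD ?jE; try lia.
  have -> : (f s + c%:Z - c%:Z = f s)%R by lia.
  have -> : (f s + c%:Z + s%:Z - c%:Z = f s + s%:Z)%R by lia.
  exact: fP.
by rewrite size_mkseq => jw; rewrite wE.
Qed.

(** Builds a maximal set with gaps at least [D]. A whole piece can be processed at once, since its
    points do not conflict with each other. *)
Fixpoint greedy (D n : nat) : set config :=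
  if n is n'.+1 then
    greedy D n' `|` (piece D n' `&` ~` [set x | exists2 s : int,
      (`|s| < D)%N & greedy D n' (shift s x)])
  else set0.

Definition markers (D : nat) : set config := \bigcup_n greedy D n.

Lemma borel_greedy (D n : nat) : borel_set (greedy D n).
Proof.
elim: n => [|n IHn] /=; first by apply: borel_open; exact: open0.
apply: borelU => //; apply: borelI; first exact: borel_piece.
apply: borelC; rewrite (_ : [set x | _] = \bigcup_k
    if (unpickle k : option int) is Some s
    then [set x | (`|s| < D)%N] `&` (shift s @^-1` greedy D n) else set0).
  apply: borel_bigcup => k; case: unpickle => [s|]; last first.
    by apply: borel_open; exact: open0.
  apply: borelI; first exact: borel_const.
  exact: (continuous_borel_map (@shift_continuous s)).
apply/seteqP; split=> x /=.
  by case=> s sD xs; exists (pickle s) => //; rewrite pickleK.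
by case=> k _; case: unpickle => [s [sD xs]|//]; exists s.
Qed.

Lemma borel_markers (D : nat) : borel_set (markers D).
Proof. by apply: borel_bigcup => n; exact: borel_greedy. Qed.

Lemma greedy_le (D m n : nat) : m <= n -> greedy D m `<=` greedy D n.
Proof.
move=> /subnK <-; elim: (n - m) => [//|k IHk] x /IHk; exact: (@or_introl).
Qed.

Lemma greedy_discrete (D n s : nat) (x : config) :
  0 < s < D -> greedy D n x -> ~ greedy D n (shift s%:Z x).
Proof.
move=> sD; elim: n => [//|n IHn] /= [gx|[px ngx]] [gsx|[psx ngsx]].
- exact: IHn gx gsx.
- apply: ngsx; exists (- s%:Z)%R; first by lia.
  by rewrite shiftD addNr shift0.
- by apply: ngx; exists (s%:Z)%R => //; lia.
- exact: piece_discrete px psx.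
Qed.

Lemma markers_discrete (D s : nat) (x : config) :
  0 < s < D -> markers D x -> ~ markers D (shift s%:Z x).
Proof.
move=> sD [m _ gx] [n _ gsx].
apply: (@greedy_discrete D (maxn m n) s x sD).
  by apply: greedy_le gx; rewrite leq_maxl.
by apply: greedy_le gsx; rewrite leq_maxr.
Qed.

Lemma markers_dense (D : nat) (x : config) : 0 < D ->
  free_part x -> exists2 s : int, (`|s| < D)%N & markers D (shift s x).
Proof.
move=> D0 Fx; have [n px] := free_piece D Fx.
have [[s sD gx]|ngx] := pselect (exists2 s : int,
    (`|s| < D)%N & greedy D n (shift s x)); first by exists s => //; exists n.
(* With no earlier marker nearby, [x] itself is added when its piece is processed. *)
by exists 0%R; [rewrite absz0 | exists n.+1 => //; rewrite shift0; right].
Qed.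

(** * The Borel 3-coloring *)

(** A marker has [d = 0]: it is the last point of its block, and the previous marker is strictly
    behind it. *)
Definition next_marker (D d : nat) : set config :=
  [set x | markers D (shift d%:Z x) /\
           forall i, i < d -> ~ markers D (shift i%:Z x)].

(* The previous marker is [p.+1] steps back. *)
Definition prev_marker (D p : nat) : set config :=
  [set x | markers D (shift (- p.+1%:Z)%R x) /\
           forall i, i < p -> ~ markers D (shift (- i.+1%:Z)%R x)].

Lemma first_nat (P : set nat) (n : nat) :
  P n -> exists m, P m /\ forall i, i < m -> ~ P i.
Proof.
move=> Pn; have ex : exists n, `[< P n >] by exists n; exact/asboolP.
case: (ex_minnP ex) => m /asboolP Pm minm; exists m; split=> // i im /asboolP.
by move=> /minm; rewrite leqNgt im.
Qed.

Lemma first_nat_unique (P : set nat) (m n : nat) :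
  (P m /\ forall i, i < m -> ~ P i) -> (P n /\ forall i, i < n -> ~ P i) ->
  m = n.
Proof.
by move=> [Pm minm] [Pn minn]; case: (ltngtP m n) => [/minn|/minm|].
Qed.

Lemma next_marker_exists (D : nat) (x : config) :
  0 < D -> free_part x -> exists d, next_marker D d x.
Proof.
(* Density is applied [D] steps ahead, so that [s + D] is positive. *)
move=> D0 Fx; have [s sD] := markers_dense D0 (free_shift (s := (D%:Z)%R) Fx).
rewrite shiftD => Ms.
apply: (@first_nat [set d | markers D (shift d%:Z x)] `|(s + D%:Z)%R|%N) => /=.
by rewrite gez0_abs //; lia.
Qed.

Lemma prev_marker_exists (D : nat) (x : config) :
  0 < D -> free_part x -> exists p, prev_marker D p x.
Proof.
move=> D0 Fx; have [s sD] := markers_dense D0 (free_shift (s := (- D%:Z)%R) Fx).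
rewrite shiftD => Ms.
apply: (@first_nat [set p | markers D (shift (- p.+1%:Z)%R x)]
                   `|(s - D%:Z)%R|%N.-1) => /=.
by have -> : (- `|(s - D%:Z)%R|%N.-1.+1%:Z = s - D%:Z)%R by lia.
Qed.

Lemma borel_next_marker (D d : nat) : borel_set (next_marker D d).
Proof.
have bM s : borel_set (shift s @^-1` markers D).
  exact: (continuous_borel_map (@shift_continuous s) (borel_markers D)).
rewrite (_ : next_marker D d = (shift d%:Z @^-1` markers D) `&` \bigcap_i
    [set x | i < d -> (~` (shift i%:Z @^-1` markers D)) x]).
  apply: borelI => //; apply: borel_bigcap => i.
  by apply: borel_implies => _; exact: borelC.
by apply/seteqP; split=> x [Mx nx]; split=> // i; [move=> _|]; exact: nx.
Qed.

Lemma borel_prev_marker (D p : nat) : borel_set (prev_marker D p).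
Proof.
have bM s : borel_set (shift s @^-1` markers D).
  exact: (continuous_borel_map (@shift_continuous s) (borel_markers D)).
rewrite (_ : prev_marker D p =
    (shift (- p.+1%:Z)%R @^-1` markers D) `&` \bigcap_i
    [set x | i < p -> (~` (shift (- i.+1%:Z)%R @^-1` markers D)) x]).
  apply: borelI => //; apply: borel_bigcap => i.
  by apply: borel_implies => _; exact: borelC.
by apply/seteqP; split=> x [Mx nx]; split=> // i; [move=> _|]; exact: nx.
Qed.

Lemma next_prev_gap (D d p : nat) (x : config) :
  next_marker D d x -> prev_marker D p x -> D <= d + p.+1.
Proof.
move=> [Md _] [Mp _]; rewrite leqNgt; apply/negP => dpD.
apply: (@markers_discrete D (d + p.+1) _ _ Mp); first by lia.
by rewrite shiftD (_ : ((d + p.+1)%:Z + - p.+1%:Z = d%:Z)%R) //; lia.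
Qed.

Lemma next_marker_shift (D d : nat) (x : config) :
  next_marker D d.+1 x -> next_marker D d (shift 1%R x).
Proof.
move=> [Md minM]; split=> [|i id].
  by rewrite shiftD (_ : (d%:Z + 1 = d.+1%:Z)%R) //; lia.
rewrite shiftD (_ : (i%:Z + 1 = i.+1%:Z)%R); last by lia.
exact: minM.
Qed.

Lemma prev_marker_shift (D d p : nat) (x : config) :
  next_marker D d.+1 x -> prev_marker D p x -> prev_marker D p.+1 (shift 1%R x).
Proof.
move=> [_ minN] [Mp minP]; split=> [|i ip].
  by rewrite shiftD (_ : (- p.+2%:Z + 1 = - p.+1%:Z)%R) //; lia.
rewrite shiftD (_ : (- i.+1%:Z + 1 = - i%:Z)%R); last by lia.
(* For [i = 0] the point is [x], not a marker because the next one is [d.+1] steps ahead. *)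
case: i ip => [_|i ip]; last exact: minP.
by rewrite oppr0; exact: (minN 0).
Qed.

Lemma prev_marker_shift0 (D : nat) (x : config) :
  next_marker D 0 x -> prev_marker D 0 (shift 1%R x).
Proof. by move=> [M0 _]; split=> //; rewrite shiftD addNr. Qed.

Section tile_distance.
Variables (L : nat) (f : nat -> nat -> nat).
Hypothesis L_gt1 : 1 < L.
Hypothesis fP : forall e, L * L <= e -> tileable L e (f e).

Local Notation D := (L * L).

Definition marker_position (x : config) : nat * nat :=
  xget (0, 0) [set dp | next_marker D dp.1 x /\ prev_marker D dp.2 x].

Definition tile_distance (x : config) : nat :=
  f ((marker_position x).1 + (marker_position x).2.+1) (marker_position x).1.

Lemma marker_position_eq (d p : nat) (x : config) :
  next_marker D d x -> prev_marker D p x -> marker_position x = (d, p).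
Proof.
move=> nd pp; rewrite /marker_position.
case: xgetP => [[d' p'] _|none]; last by case: (none (d, p)).
move=> [/= nd' pp'].
by rewrite (first_nat_unique nd nd') (first_nat_unique pp pp').
Qed.

Lemma marker_positionP (x : config) : free_part x ->
  exists d p, [/\ next_marker D d x, prev_marker D p x,
    marker_position x = (d, p) & tileable L (d + p.+1) (f (d + p.+1))].
Proof.
move=> Fx; have D0 : 0 < D by nia.
have [d nd] := next_marker_exists D0 Fx.
have [p pp] := prev_marker_exists D0 Fx.
exists d, p; split=> //; first exact: marker_position_eq.
by apply: fP; exact: next_prev_gap nd pp.
Qed.

Lemma tile_distance_lt (x : config) : free_part x -> tile_distance x < L.
Proof.
move=> /marker_positionP[d [p [_ _ pE [_ fL _ _]]]].
by rewrite /tile_distance pE /=; apply: fL; lia.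
Qed.

(** This is the sawtooth hypothesis along an orbit. Inside a block it is the step clause of
    [tileable]; across a marker it comes from the clauses for the two ends of a block. *)
Lemma tile_distance_step (x : config) : free_part x ->
  tile_distance x = (tile_distance (shift 1%R x)).+1 \/
  tile_distance x = 0 /\ L <= (tile_distance (shift 1%R x)).+2.
Proof.
move=> Fx; have [d [p [nd pp pE [f0 fL fS fe]]]] := marker_positionP Fx.
have [d' [p' [nd' pp' pE' [f0' fL' fS' fe']]]] :=
  marker_positionP (free_shift (s := 1%R) Fx).
rewrite /tile_distance pE pE' /=.
case: d nd pE f0 fL fS fe => [|d] nd pE f0 fL fS fe.
  (* Here [x] is a marker, so the next point is the first of a new block, at distance [e.-1] from
     its end. *)
  right; split=> //.
  have p'0 := first_nat_unique pp' (prev_marker_shift0 nd).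
  by move: fe'; rewrite p'0 addn1.
have dE := first_nat_unique (next_marker_shift nd) nd'.
have pE2 := first_nat_unique (prev_marker_shift nd pp) pp'.
rewrite -dE -pE2 (_ : d + p.+2 = d.+1 + p.+1); last by lia.
by apply: fS; lia.
Qed.

(** The tile distance is constant on each of the countably many Borel sets given by [d] and [p]. *)
Lemma borel_tile_distance (B : set nat) :
  borel_set [set x : free_part | B (tile_distance (set_val x))].
Proof.
have bval (A : set config) :
  borel_set A -> borel_set [set x : free_part | A (set_val x)].
  exact: (continuous_borel_map (@initial_continuous _ _ set_val)).
rewrite (_ : [set x | _] = \bigcup_d \bigcup_p ([set x : free_part |
  (next_marker D d `&` prev_marker D p) (set_val x)] `&`
  [set _ | B (f (d + p.+1) d)])).
  apply: borel_bigcup => d; apply: borel_bigcup => p.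
  apply: borelI; last exact: borel_const.
  by apply: bval; apply: borelI; [exact: borel_next_marker|
                                  exact: borel_prev_marker].
apply/seteqP; split=> x /=; rewrite /tile_distance.
  have [d [p [nd pp -> _]]] := marker_positionP (set_valP x).
  by move=> Bx; exists d => //; exists p.
by move=> [d _ [p _ [[nd pp] Bx]]]; rewrite (marker_position_eq nd pp).
Qed.

End tile_distance.

Lemma path_ltn_bounds (b x : nat) (s : seq nat) :
  path ltn b s -> x \in b :: s -> b <= x <= last b s.
Proof.
elim: s b x => [|c s IHs] b x /=.
  by rewrite inE => _ /eqP ->; rewrite !leqnn.
move=> /andP[bc cs]; rewrite inE => /orP[/eqP ->|xcs].
  by have := IHs c c cs (mem_head c s); lia.
by have := IHs c x cs xcs; lia.
Qed.

Lemma borel_colorable_3 (a : seq nat) :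
  sorted ltn a -> all (fun x => 0 < x) a -> last 0 a < 2 * head 0 a ->
  borel_colorable (schreier_adj (signed_set a)) 3.
Proof.
move=> sa a_gt0 a_lt; set h := head 0 a in a_lt.
have h_gt0 : 0 < h by lia.
have a_bnd x : x \in a -> h <= x < 2 * h.
  case: a sa @h a_lt {a_gt0 h_gt0} => [//|b s] /= bs a_lt xbs.
  by have /andP[-> xl] := path_ltn_bounds bs xbs; exact: leq_ltn_trans xl a_lt.
have /choice[f fP] e : exists g, 3 * h * (3 * h) <= e -> tileable (3 * h) e g.
  have [he|_] := leqP (3 * h * (3 * h)) e; last by exists id.
  by have [|g] := @tileable_large (3 * h) e _ he; [lia | exists g].
pose u := tile_distance (3 * h) f.
have L1 : 1 < 3 * h by lia.
exists 'I_3; first by rewrite card_ord.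
exists (fun x : free_part => inord (u (set_val x) %/ h)) => [B _|x y].
  exact: (borel_tile_distance L1 fP [set n | B (inord (n %/ h))]).
have uP (z t : free_part) s : s \in a -> shift s%:Z (set_val z) = set_val t ->
    u (set_val z) %/ h <> u (set_val t) %/ h.
  move=> sa' zt; rewrite -zt.
  have := @sawtooth_color h (fun n => u (shift n%:Z (set_val z))) h_gt0 _ s
    (a_bnd _ sa').
  rewrite shift0; apply=> n.
  rewrite (_ : n.+1%:Z = 1 + n%:Z)%R; last by lia.
  rewrite -shiftD; apply: tile_distance_step => //.
  exact: free_shift (set_valP z).
have u3 (z : free_part) : u (set_val z) %/ h < 3.
  by rewrite ltn_divLR //; exact: tile_distance_lt (set_valP z).
move=> [s [b ba [->|->]] xy] /(congr1 val) /=; rewrite !inordK //.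
  exact: uP xy.
(* A negative shift from [x] to [y] is a positive one from [y] to [x]. *)
by move=> /esym; apply: uP ba _; rewrite -xy shiftD addrN shift0.
Qed.

(** * Baire category and the lower bound *)

(** Cylinders form a base, so this says that [U] contains a dense open set. *)
Definition dense_interior (U : set config) : Prop :=
  forall n x, exists m y, [/\ n <= m, cylinder n x y & cylinder m y `<=` U].

Definition comeager (A : set config) : Prop :=
  exists2 U : nat -> set config, (forall k, dense_interior (U k)) &
    \bigcap_k U k `<=` A.

Lemma comeager_sub (A B : set config) : A `<=` B -> comeager A -> comeager B.
Proof. by move=> AB [U dU UA]; exists U => //; exact: subset_trans AB. Qed.

Lemma dense_interior_comeager (U : set config) : dense_interior U -> comeager U.
Proof. by move=> dU; exists (fun=> U) => // x /(_ 0 I). Qed.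

Lemma comeager_bigcap (T : countType) (A : T -> set config) :
  (forall i, comeager (A i)) -> comeager [set x | forall i, A i x].
Proof.
move=> cA; have /choice[U UP] i : exists U : nat -> set config,
    (forall k, dense_interior (U k)) /\ \bigcap_k U k `<=` A i.
  by have [U] := cA i; exists U.
exists (fun k => if (unpickle k : option (T * nat)) is Some (i, j)
                 then U i j else setT) => [k|x Ux i].
  case: unpickle => [[i j]|]; first by have [dU _] := UP i; exact: dU.
  by move=> n x; exists n, x.
have [_] := UP i; apply=> j _.
by have := Ux (pickle (i, j)) I; rewrite pickleK.
Qed.

Lemma comeagerI (A B : set config) :
  comeager A -> comeager B -> comeager (A `&` B).
Proof.
move=> cA cB.
apply: comeager_sub (@comeager_bigcap bool (fun b => if b then A else B) _).
  by move=> x AB; split; [exact: (AB true)|exact: (AB false)].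
by case.
Qed.

(* The Baire category theorem for the space of configurations. *)
Lemma comeager_cylinder (A : set config) (n : nat) (x : config) :
  comeager A -> exists2 y, cylinder n x y & A y.
Proof.
move=> [U dU UA].
have /choice[next nextP] (kp : nat * (nat * config)) : exists q : nat * config,
    [/\ kp.2.1 < q.1, cylinder kp.2.1 kp.2.2 q.2
      & cylinder q.1 q.2 `<=` U kp.1].
  have [m [y [nm xy yU]]] := dU kp.1 kp.2.1 kp.2.2.
  (* Taking [m.+1] makes the radii strictly increase, so the nested cylinders fix every
     coordinate. *)
  exists (m.+1, y); split=> //=.
  by apply: subset_trans yU; exact: cylinder_le.
pose fix q k := if k is k'.+1 then next (k', q k') else (n, x).
have qP k : [/\ (q k).1 < (q k.+1).1, cylinder (q k).1 (q k).2 (q k.+1).2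
    & cylinder (q k.+1).1 (q k.+1).2 `<=` U k] := nextP (k, q k).
have q_ge k : k <= (q k).1.
  by elim: k => [//|k IHk]; have [qk _ _] := qP k; exact: leq_ltn_trans IHk qk.
have q_le j k : (q k).1 <= (q (j + k)).1.
  elim: j => [//|j IHj]; have [qj _ _] := qP (j + k).
  exact: leq_trans IHj (ltnW qj).
have q_cyl j k : cylinder (q k).1 (q k).2 (q (j + k)).2.
  elim: j => [|j IHj]; first by [].
  by have [_ qj _] := qP (j + k); exact: cylinder_trans (q_le j k) IHj _ qj.
pose y : config := fun i => (q `|i|%N.+1).2 i.
have yP k : cylinder (q k).1 (q k).2 y.
  move=> i ik; rewrite /y; have [kl|lk] := leqP k (`|i|%N.+1).
    by have := q_cyl (`|i|%N.+1 - k) k; rewrite subnK //; apply.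
  have := q_cyl (k - `|i|%N.+1) (`|i|%N.+1); rewrite subnK; last exact: ltnW.
  by move=> -> //; exact: q_ge.
exists y; first exact: (yP 0).
by apply: UA => k _; have [_ _] := qP k; apply; exact: yP.
Qed.

Lemma comeager_shift (s : int) (A : set config) :
  comeager A -> comeager (shift s @^-1` A).
Proof.
move=> [U dU UA]; exists (fun k => shift s @^-1` U k); last first.
  by move=> x Ux; apply: UA => k _; exact: Ux.
(* Shifting displaces a window by [s], so radii grow by its absolute value in each direction. *)
move=> k n x; have [m [y [nm xy yU]]] := dU k (n + `|s|) (shift s x).
exists (m + `|s|), (shift (- s)%R y); split; first by lia.
  move=> i ni; rewrite /shift xy; last by lia.
  by rewrite /shift; congr (x _); lia.
move=> z yz; apply: yU => i im; rewrite /shift yz; last by lia.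
by rewrite /shift; congr (y _); lia.
Qed.

Lemma comeager_free_part : comeager free_part.
Proof.
apply: comeager_bigcap => s.
have [->|s0] := eqVneq s 0%R.
  by exists (fun=> setT) => // _ n x; exists n, x.
apply: dense_interior_comeager => n x.
(* With the sign of [s], both [i] and [i + s] avoid the prescribed window; [y] is made to differ
   there. *)
pose i : int := if (0 < s)%R then (n%:Z)%R else (- n%:Z)%R.
have [in_ isn] : (`|i| = n)%N /\ (n <= `|(i + s)%R| <= n + `|s|)%N.
  by rewrite /i; case: ifPn => ?; lia.
pose y : config := fun j => if (`|j| < n)%N then x j else j == i.
exists (n + `|s|).+1, y; split; first by lia.
  by move=> j jn; rewrite /y jn.
move=> z yz _ /(congr1 (@^~ i)); rewrite /shift !yz; try lia.
rewrite /y.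
have -> : (`|(i + s)%R| < n)%N = false by lia.
have -> : (`|i| < n)%N = false by lia.
have -> : (i + s == i)%R = false by lia.
by rewrite eqxx.
Qed.

(** The Baire property, tested in the whole space; points outside the free part satisfy the
    condition vacuously. *)
Definition baire_set (B : set free_part) : Prop :=
  exists2 U : set config, (forall x, U x -> exists n, cylinder n x `<=` U) &
    comeager [set x | forall y : free_part, set_val y = x -> B y <-> U x].

(** The open set for the complement is the interior [V] of the complement of [U]; the union of [U]
    and [V] is open and dense. *)
Lemma baire_setC (B : set free_part) : baire_set B -> baire_set (~` B).
Proof.
move=> [U oU BU].
pose V : set config := [set x | exists n, cylinder n x `<=` ~` U].
have oV x : V x -> exists n, cylinder n x `<=` V.
  move=> [n xU]; exists n => y xy; exists n => z yz; apply: xU.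
  exact: cylinder_trans xy _ yz.
exists V => //.
have cUV : comeager (U `|` V).
  apply: dense_interior_comeager => n x.
  have [[y xy Uy]|nU] := pselect (exists2 y, cylinder n x y & U y).
    have [m yU] := oU y Uy; exists (maxn n m), y; split; rewrite ?leq_maxl //.
    by move=> z yz; left; apply: yU; apply: cylinder_le yz; rewrite leq_maxr.
  exists n, x; split=> // y xy; right; exists n => z yz Uz; apply: nU.
  by exists z => //; exact: cylinder_trans xy _ yz.
apply: comeager_sub (comeagerI BU cUV) => x [BUx UVx] y yx.
have VnU : V x -> ~ U x by move=> [n]; apply.
split=> [nBy|Vx By]; last by apply: (VnU Vx); exact/(BUx y yx).
by case: UVx => // Ux; case: nBy; exact/(BUx y yx).
Qed.

Lemma baire_set_bigcup (F : nat -> set free_part) :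
  (forall n, baire_set (F n)) -> baire_set (\bigcup_n F n).
Proof.
move=> bF; have /choice[U UP] n : exists U : set config,
    (forall x, U x -> exists n, cylinder n x `<=` U) /\
    comeager [set x | forall y : free_part, set_val y = x -> F n y <-> U x].
  by have [U] := bF n; exists U.
exists (\bigcup_n U n).
  move=> x [n _ Ux]; have [/(_ x Ux)[m xU] _] := UP n.
  by exists m => y /xU Uy; exists n.
apply: comeager_sub (comeager_bigcap (fun n => proj2 (UP n))) => x FU y yx.
by split=> -[n _ Fy]; exists n => //; exact/(FU n y yx).
Qed.

Lemma borel_baire_set (B : set free_part) : borel_set B -> baire_set B.
Proof.
apply: (smallest_sub (X := baire_set)).
  split=> [|A|]; [|by rewrite setTD; exact: baire_setC|exact: baire_set_bigcup].
  by exists set0 => //; exists (fun=> setT) => // _ n x; exists n, x.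
move=> _ [U oU <-]; exists U; first by move=> x; exact: open_cylinder_sub.
exists (fun=> setT); first by move=> _ n x; exists n, x.
by move=> x _ y <-.
Qed.

(** The color [k] of a generic point is generic in a cylinder around it. A generic [z] showing the
    pattern of that cylinder both at 0 and at [m] has color [k], and so has its shift by [m]. *)
Lemma borel_colors_repeat (K : countType) (c : free_part -> K) :
  (forall k, borel_set (c @^-1` [set k])) ->
  exists N : nat, forall m : int, (N <= `|m|)%N ->
    exists x y : free_part, shift m (set_val x) = set_val y /\ c x = c y.
Proof.
move=> bc; have /choice[U UP] k : exists U : set config,
    (forall x, U x -> exists n, cylinder n x `<=` U) /\
    comeager [set x | forall y : free_part, set_val y = x -> c y = k <-> U x].
  by have [U] := borel_baire_set (bc k); exists U.
have cG := comeagerI comeager_free_part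
  (comeager_bigcap (fun k => proj2 (UP k))).
have [x _ [Fx xU]] := comeager_cylinder 0 (fun=> false) cG.
pose x' : free_part := SigSub (mem_set Fx).
pose k := c x'.
have Ux : U k x by apply/(xU k x').
have [/(_ x Ux)[n xnU] _] := UP k.
(* From distance [n + n] on, the windows of radius [n] about 0 and [m] are disjoint. *)
exists (n + n) => m nm.
pose y : config := fun i => if (`|i| < n)%N then x i else x (i - m)%R.
have [z yz [[Fz zU] [Fmz mzU]]] :=
  comeager_cylinder (n + `|m|) y (comeagerI cG (comeager_shift m cG)).
exists (SigSub (mem_set Fz)), (SigSub (mem_set Fmz)); split=> //.
transitivity k; last apply: esym.
  apply/(zU k) => //; apply: xnU => i ni; rewrite yz; last by lia.
  by rewrite /y ni.
apply/(mzU k) => //; apply: xnU => i ni; rewrite /shift yz; last by lia.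
rewrite /y ifN; last by lia.
by congr (x _); lia.
Qed.

Lemma not_borel_colorable (S : set int) (s : int) (k : nat) :
  s <> 0%R -> S s -> k < 3 -> ~ borel_colorable (schreier_adj S) k.
Proof.
move=> s0 Ss k3 [K Kk [c bc cadj]].
have [|N NP] := @borel_colors_repeat K c.
  by move=> i; apply: bc; apply: borel_open; exact: discrete_open.
have alt (u v w : K) : u <> v -> v <> w -> u = w.
  move=> uv vw; apply/eqP/negPn/negP => uw.
  have /card_uniqP uvwE : uniq [:: u; v; w].
    by rewrite /= !inE (introF eqP uv) (negPf uw) (introF eqP vw).
  by have := max_card (mem [:: u; v; w]); rewrite uvwE Kk leqNgt k3.
have flip j (x y : free_part) :
    shift (s * (j.*2.+1)%:Z)%R (set_val x) = set_val y -> c x <> c y.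
  elim: j x y => [|j IHj] x y xy.
    by apply: cadj; exists s => //; rewrite mulr1 in xy.
  pose p t : free_part := SigSub (mem_set (free_shift (s := t) (set_valP x))).
  have c1 : c x <> c (p s) by apply: cadj; exists s.
  have c2 : c (p s) <> c (p (s + s)%R).
    by apply: cadj; exists s => //=; rewrite shiftD.
  (* Two steps of [s] restore the color, which leaves a smaller odd multiple. *)
  rewrite (alt _ _ _ c1 c2); apply: (IHj (p (s + s)%R) y) => /=.
  rewrite -xy shiftD (_ : (j.+1.*2.+1)%:Z = (j.*2.+1)%:Z + (1 + 1))%R.
    by rewrite !mulrDr mulr1.
  lia.
(* An odd multiple of [s] of absolute value at least [N]. *)
have [|x [y [xy cxy]]] := NP (s * (N.*2.+1)%:Z)%R; first rewrite abszM.
  by apply: leq_trans (leq_pmull _ _); lia.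
exact: flip xy cxy.
Qed.

Theorem theorem5p10 (a : seq nat) (ha : Sigma a)
    (hlt : last 0 a < 2 * head 0 a) :
  chi a = Some 3.
Proof.
have [sa a0 _] := ha.
have c3 := borel_colorable_3 sa a0 hlt.
have n3 k : k < 3 -> ~ borel_colorable (schreier_adj (signed_set a)) k.
  case: a hlt a0 {ha sa c3} => [//|h t] _ /= /andP[h0 _].
  apply: (@not_borel_colorable _ (h%:Z)%R); first by lia.
  by exists h; [exact: mem_head | left].
rewrite /chi /borel_chromatic_number; case: pselect => [ex|[]]; last first.
  by exists 3; exact/asboolP.
congr Some; case: ex_minnP => m /asboolP cm minm.
have m_le3 : m <= 3 by apply: minm; exact/asboolP.
have [/n3/(_ cm) []|m_ge3] := ltnP m 3.
by apply: anti_leq; rewrite m_le3 m_ge3.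
Qed.
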